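(* Let $(X,f)$ be a cascade on a compact metric space $X$ with $E(X)$ infinite, and let $(2^X,f_* )$ be the induced cascade. The following are equivalent: (i) $(E(2^X),f_* )$ is topologically transitive; (ii) the identity $e_*$ is not isolated in $E(2^X)$; (iii) $(X,f)$ is uniformly rigid. Moreover, in this case $(E(X),f)$ is topologically transitive.
   Context: A cascade $(X,f)$ is a homeomorphism $f$ of a compact metric space $(X,d)$. $2^X$ is the space of all nonempty closed subsets of $X$ with the Vietoris (Hausdorff metric) topology, and $f_*(A)=f(A)$. For a cascade $(Y,g)$ the enveloping semigroup $E(Y)=E(Y,g)$ is the closure of $\{g^n:n\in\mathbb{Z}\}$ in $Y^Y$ with the product topology, and $(E(Y),g)$ denotes the system $p\mapsto g\circ p$ on $E(Y)$. $e_*$ is the identity map of $2^X$. A system $(Z,h)$ is topologically transitive if for every pair of nonempty open sets $U,V\subset Z$ there is an $n\in\mathbb{N}=\{1,2,\dots\}$ with $h^n(U)\cap V\neq\emptyset$. $(X,f)$ is uniformly rigid if there is a sequence $n_k\nearrow\infty$ in $\mathbb{N}$ such that $f^{n_k}\to \mathrm{id}_X$ uniformly on $X$. *)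

(* Defs.v *)
From HB Require Import structures.
From mathcomp Require Import all_boot all_order all_algebra finmap.
From mathcomp Require Import all_classical all_reals topology.

Set Implicit Arguments.
Unset Strict Implicit.
Unset Printing Implicit Defensive.

Local Open Scope classical_set_scope.

Record homeo (Y : topologicalType) := Homeo {
  homeo_fun :> Y -> Y ;
  homeo_inv : Y -> Y ;
  homeoK : cancel homeo_fun homeo_inv ;
  homeo_invK : cancel homeo_inv homeo_fun ;
  homeo_continuous : continuous homeo_fun ;
  homeo_inv_continuous : continuous homeo_inv }.

Definition iterz (Y : topologicalType) (g : homeo Y) (n : int) : Y -> Y :=
  match n with
  | Posz m => iter m g
  | Negz m => iter m.+1 (homeo_inv g)
  end.

Definition hyperspace (X : topologicalType) : Type :=
  {A : set X | closed A /\ A !=set0}.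

HB.instance Definition _ (X : topologicalType) := gen_eqMixin (hyperspace X).
HB.instance Definition _ (X : topologicalType) :=
  gen_choiceMixin (hyperspace X).

(* The Vietoris topology: on a compact metric space it is also the topology of
   the Hausdorff metric. *)
Definition vietoris_subbase (X : topologicalType) : set (set (hyperspace X)) :=
  [set [set A | sval A `<=` U] | U in open] `|`
  [set [set A | sval A `&` U !=set0] | U in open].

HB.instance Definition _ (X : topologicalType) :=
  isSubBaseTopological.Build (hyperspace X) (@vietoris_subbase X) id.

Section induced.
Variables (X : topologicalType).

Lemma hyperspace_inj (A B : hyperspace X) : sval A = sval B -> A = B.
Proof.
by case: A B => [A hA] [B hB] /= AB; subst B; congr exist; apply: Prop_irrelevance.
Qed.

Lemma homeo_image (g : homeo X) (A : set X) : g @` A = homeo_inv g @^-1` A.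
Proof.
apply/seteqP; split => [_ [x Ax <-]|x Ax] /=; first by rewrite homeoK.
by exists (homeo_inv g x) => //; rewrite homeo_invK.
Qed.

Lemma homeo_image_closed (g : homeo X) (A : hyperspace X) :
  closed (g @` sval A) /\ g @` sval A !=set0.
Proof.
case: A => A [cA [x Ax]] /=; split; last by exists (g x), x.
rewrite homeo_image; apply: preimage_closed => // y _.
exact: homeo_inv_continuous.
Qed.

Definition hyper_map (g : homeo X) (A : hyperspace X) : hyperspace X :=
  exist _ (g @` sval A) (homeo_image_closed g A).

Definition homeo_sym (g : homeo X) : homeo X :=
  Homeo (@homeo_invK _ g) (@homeoK _ g)
    (@homeo_inv_continuous _ g) (@homeo_continuous _ g).

Lemma hyper_mapK (g : homeo X) :
  cancel (hyper_map g) (hyper_map (homeo_sym g)).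
Proof.
move=> A; apply: hyperspace_inj => /=; rewrite image_comp.
by under eq_imagel do rewrite /= homeoK; rewrite image_id.
Qed.

Lemma hyper_map_continuous (g : homeo X) : continuous (hyper_map g).
Proof.
have openV (U : set (hyperspace X)) : vietoris_subbase U -> open U.
  move=> SU; exists [set U]; last by rewrite bigcup_set1.
  move=> _ ->; exists [fset U]%fset; last by rewrite set_fset1 bigcap_set1.
  by move=> V /fset1P ->; exact: mem_set.
have openP (U : set X) : open U -> open (g @^-1` U).
  by move=> oU; apply: open_comp => // x _; exact: homeo_continuous.
move=> A W; rewrite nbhsE /= => -[_ [[D sD <-] [B DB BA]] sDW].
have [F sF FB] := sD _ DB; move: BA; rewrite -FB => FA.
suff : nbhs A (hyper_map g @^-1` B).
  by apply: filterS => C BC; apply: sDW; exists B.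
rewrite -FB preimage_bigcap; apply: filter_bigI => V FV.
have {}FA := FA _ FV; have := sF _ FV; rewrite inE => VS.
apply: open_nbhs_nbhs; split => //.
apply: openV; case: VS => -[U oU <-]; [left|right]; exists (g @^-1` U);
  do ?[exact: openP].
- by apply/seteqP; split => C /=; rewrite image_subP.
- apply/seteqP; split => C /= -[x].
    by move=> [Cx Ux]; exists (g x); split => //; exists x.
  by move=> [[y Cy <-] Uy]; exists y.
Qed.

End induced.

Lemma hyper_map_symK (X : topologicalType) (g : homeo X) :
  cancel (hyper_map (homeo_sym g)) (hyper_map g).
Proof.
move=> A; apply: hyperspace_inj => /=; rewrite image_comp.
by under eq_imagel do rewrite /= homeo_invK; rewrite image_id.
Qed.

Definition induced (X : topologicalType) (f : homeo X) : homeo (hyperspace X) :=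
  Homeo (@hyper_mapK _ f) (@hyper_map_symK _ f)
    (@hyper_map_continuous _ f) (@hyper_map_continuous _ (homeo_sym f)).

Definition enveloping (Y : topologicalType) (g : homeo Y) : set {ptws Y -> Y} :=
  closure (range (iterz g : int -> {ptws Y -> Y})).

Lemma iterzS (Y : topologicalType) (g : homeo Y) (n : int) (y : Y) :
  iterz g (n + 1)%R y = g (iterz g n y).
Proof.
case: n => [n|[|n]].
- by rewrite -[1%R]/(Posz 1) -PoszD addn1.
- by rewrite /= homeo_invK.
- have -> : (Negz n.+1 + 1 = Negz n)%R.
    by rewrite !NegzE -[n.+2]addn1 PoszD GRing.opprD GRing.subrK.
  by rewrite /= homeo_invK.
Qed.

Lemma enveloping_comp (Y : topologicalType) (g : homeo Y) (p : {ptws Y -> Y}) :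
  enveloping g p -> enveloping g (g \o p).
Proof.
have ptws_comp : continuous (comp g : {ptws Y -> Y} -> {ptws Y -> Y}).
  move=> q; have FF : Filter (comp g @ nbhs (q : {ptws Y -> Y})).
    by apply: fmap_filter; exact: (@nbhs_filter {ptws Y -> Y} q).
  apply/cvg_sup => y U [_ [[V oV <-] /= Vq] sVU].
  rewrite nbhs_filterE; apply: filterS sVU _.
  have : nbhs (q y) (g @^-1` V).
    apply: open_nbhs_nbhs; split => //.
    by apply: open_comp => // z _; exact: homeo_continuous.
  exact: (@proj_continuous {classic Y} (fun=> Y) y q).
move=> Ep B /ptws_comp /Ep [_ [[n _ <-] /= Bn]].
exists (g \o iterz g n); split => //; exists (n + 1)%R => //.
by apply/funext => y; rewrite /= iterzS.
Qed.

(* The system (E(Y), g), where E(Y) carries the subspace topology. *)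
Definition enveloping_map (Y : topologicalType) (g : homeo Y)
    (p : enveloping g) : enveloping g :=
  exist _ (g \o set_val p) (mem_set (enveloping_comp (set_valP p))).

Definition topologically_transitive (Z : topologicalType) (h : Z -> Z) :=
  forall U V : set Z, open U -> open V -> U !=set0 -> V !=set0 ->
  exists2 n : nat, (0 < n)%N & (iter n h @` U) `&` V !=set0.

(* For a strictly increasing sequence of naturals, n_k tends to infinity. *)
Definition uniformly_rigid (X : uniformType) (f : X -> X) :=
  exists n : nat -> nat,
    [/\ forall k, (0 < n k)%N, {homo n : i j / (i < j)%N} &
        {uniform, (fun k => iter (n k) f) @ \oo --> (id : X -> X)}].

(* Main.v *)
Require Import Defs.
From mathcomp Require Import all_boot all_order all_algebra finmap.
From mathcomp Require Import all_classical all_reals interval_inference.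
From mathcomp Require Import topology normedtype.
From mathcomp Require Import zify.

Import Order.TTheory GRing.Theory Num.Theory.

Local Open Scope classical_set_scope.

(** Everything reduces to how the powers of a homeomorphism [g] of a space [Y]
    return to the identity in the pointwise topology, applied to [Y = X] with
    [g = f] and to [Y] the hyperspace of [X] with [g] induced by [f].

    Transitivity to non-isolation.  If the identity were isolated in the
    enveloping semigroup, it would form an open set, and transitivity would
    bring that open set back to itself: some positive power of the induced map
    would be the identity ([transitive_isolated_periodic]).  Looking at
    singletons, [f] would then be periodic and its enveloping semigroup finite
    ([periodic_enveloping_finite]).

    Non-isolation to uniform rigidity.  The hyperspace is T1, so a
    non-isolated identity is a limit point of the powers themselves
    ([not_isolated_id]), and some nontrivial power of the induced map lies in
    any given neighbourhood of the identity.  A pointwise neighbourhood on the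
    hyperspace constrains finitely many closed sets; choosing closures of balls
    that cover [X], it already forces a uniform estimate on [X]
    ([induced_recurrence_ball]).  This is where hyperspace recurrence is
    stronger than pointwise recurrence on [X].  The exponent may be made
    positive, since a uniform estimate for a bijection is one for its inverse,
    and large, since multiples of a return time with a much better estimate
    still return ([uniformly_rigid_ball]).

    Uniform rigidity to transitivity.  Uniform convergence of
    [iter (n k) f] to the identity gives pointwise convergence on the
    hyperspace, because a compact set inside an open set stays there under
    small uniform perturbations ([uniform_cvg_induced]).  Along any increasing
    sequence of powers tending pointwise to the identity, the enveloping
    semigroup is transitive ([rigid_transitive]): powers [g^m] and [g^l] are
    found in the two given open sets, and [g^(n k + l - m)] carries [g^m] to
    [g^l] composed with [g^(n k)], which is close to [g^l], while the exponent
    [n k + l - m] is eventually positive.  The same lemma on [X] itself gives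
    the last assertion. *)

(** * Integer iterates of a homeomorphism *)

Section iterates.
Variables (Y : topologicalType) (g : homeo Y).

Lemma iterzD (m n : int) (y : Y) :
  iterz g (m + n)%R y = iterz g m (iterz g n y).
Proof.
elim/int_rect: m => [|m IHm|m IHm]; first by rewrite add0r.
- rewrite (_ : (m.+1%:Z + n)%R = (m%:Z + n + 1)%R); last by lia.
  by rewrite iterzS IHm (_ : Posz m.+1 = (m%:Z + 1)%R) ?iterzS; last by lia.
- apply: (can_inj (homeoK g)); rewrite -!iterzS.
  rewrite (_ : (- m.+1%:Z + n + 1)%R = (- m%:Z + n)%R); last by lia.
  by rewrite (_ : (- m.+1%:Z + 1)%R = (- m%:Z)%R); last by lia.
Qed.

Lemma iter_continuous (h : Y -> Y) (n : nat) :
  continuous h -> continuous (iter n h).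
Proof.
move=> ch; elim: n => [|n IHn] y; first exact: cvg_id.
apply: continuous_comp; [exact: IHn|exact: ch].
Qed.

Lemma iterz_continuous (n : int) : continuous (iterz g n).
Proof.
case: n => n /=; first exact: iter_continuous (@homeo_continuous _ g).
exact: (@iter_continuous _ n.+1 (@homeo_inv_continuous _ g)).
Qed.

Lemma iter_homeo_invK (n : nat) : cancel (iter n g) (iter n (homeo_inv g)).
Proof.
elim: n => // n IHn y.
by rewrite iterSr iterS homeoK IHn.
Qed.

(** A negative power is a positive one too, since [homeo_inv g] is then
    [iter n.-1 g]; so every power is one of the first [n] iterates. *)
Lemma periodic_range_finite (n : nat) :
  (0 < n)%N -> iter n g = id -> finite_set (range (iterz g)).
Proof.
move=> n0 gn.
have iter_mod m : iter m g = iter (m %% n) g.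
  apply/funext => y; rewrite {1}(divn_eq m n) addnC iterD iterM gn.
  by rewrite (@iter_fix _ _ id).
have invE : homeo_inv g =1 iter n.-1 g.
  move=> y; apply: (can_inj (homeoK g)); rewrite homeo_invK.
  by rewrite -iterS prednK // gn.
apply: (@sub_finite_set _ _ ((fun m : nat => iter m g) @` `I_n)); last first.
  exact: finite_image (finite_II n).
move=> _ [[m|m] _ <-] /=.
- by exists (m %% n)%N; rewrite /= ?ltn_mod // -iter_mod.
- exists ((m.+1 * n.-1) %% n)%N; rewrite /= ?ltn_mod // -iter_mod.
  by apply/funext => y; rewrite iterM; apply: eq_iter => z; rewrite invE.
Qed.

End iterates.

(** * The topology of pointwise convergence *)

Section pointwise_topology.
Variable Y : topologicalType.

Lemma ptws_cvg (F : set_system {ptws Y -> Y}) (p : {ptws Y -> Y}) :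
  Filter F -> (forall y, q y @[q --> F] --> p y) -> F --> p.
Proof.
move=> FF Fp; apply/cvg_sup => y U [_ [[V oV <-] /= Vp] sVU].
rewrite nbhs_filterE; apply: filterS sVU _.
by apply: Fp; apply: open_nbhs_nbhs.
Qed.

Lemma ptws_eval (y : Y) : continuous (fun p : {ptws Y -> Y} => p y).
Proof. exact: (@proj_continuous {classic Y} (fun=> Y) y). Qed.

Lemma ptws_comp_continuous (h : Y -> Y) :
  continuous h -> continuous (comp h : {ptws Y -> Y} -> {ptws Y -> Y}).
Proof.
move=> ch q.
have FF : Filter (comp h @ nbhs (q : {ptws Y -> Y})).
  by apply: fmap_filter; exact: (@nbhs_filter {ptws Y -> Y} q).
apply: ptws_cvg => y.
exact: (@continuous_comp _ _ _ (fun p : {ptws Y -> Y} => p y) h _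
  (@ptws_eval y q) (ch _)).
Qed.

Lemma accessible_ptws :
  accessible_space Y -> accessible_space {ptws Y -> Y}.
Proof.
move=> T1 p q /eqP pq.
have [y pqy] : exists y, p y != q y.
  apply: contrapT => /forallNP H; apply: pq; apply/funext => y.
  by apply/eqP/negPn/negP/H.
have [A [oA pA qA]] := T1 _ _ pqy.
exists ((fun r : {ptws Y -> Y} => r y) @^-1` A); split.
- by apply: open_comp => // r _; exact: ptws_eval.
- by move: pA; rewrite !inE.
- by move: qA; rewrite !inE.
Qed.

End pointwise_topology.

(** * Isolated points and limit points *)

Section limit_points.
Variable T : topologicalType.

Lemma not_isolatedP (A : set T) (x : T) :
  A x -> (~ isolated A x) <-> limit_point A x.
Proof.
move=> Ax; split => [nI|lA iA].
  have : closure A x by exact: subset_closure.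
  by rewrite closure_isolated_limit_point => -[].
have /disj_setPS := disjoint_isolated_limit_point A.
by move=> /(_ x) [].
Qed.

(** A neighbourhood of [x] that meets [closure A] at some [y != x] can be
    shrunk around [y] so as to avoid [x]; it then meets [A] away from [x]. *)
Lemma limit_point_closure (A : set T) :
  accessible_space T -> limit_point (closure A) = limit_point A.
Proof.
move=> T1; apply/seteqP; split => x lx U Ux; last first.
  by have [y [yx Ay Uy]] := lx _ Ux; exists y; split=> //; exact: subset_closure.
move: Ux; rewrite nbhsE => -[O [oO Ox] OU].
have [y [yx clAy Oy]] := lx _ (open_nbhs_nbhs (conj oO Ox)).
have [B [oB /set_mem By /set_mem Bx]] := T1 _ _ yx.
have [z [Az [Oz Bz]]] : A `&` (O `&` B) !=set0.
  by apply: clAy; apply: open_nbhs_nbhs; split => //; exact: openI.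
exists z; split => //; last exact: OU.
by apply/eqP => zx; apply: Bx; rewrite -zx.
Qed.

End limit_points.

(** * Recurrence of the identity and the enveloping semigroup *)

Section enveloping_semigroup.
Variables (Y : topologicalType) (g : homeo Y).

Lemma periodic_enveloping_finite (n : nat) : accessible_space Y ->
  (0 < n)%N -> iter n g = id -> finite_set (enveloping g).
Proof.
move=> T1 n0 gn; have fin := periodic_range_finite _ _ _ n0 gn.
rewrite /enveloping.
have /closure_id <- // := (iffLR (@accessible_finite_set_closed {ptws Y -> Y})
  (accessible_ptws _ T1)) _ fin.
Qed.

(** Non-isolation only speaks of elements of the semigroup, which may be
    limits of powers; the T1 property replaces them by actual powers. *)
Lemma not_isolated_id : accessible_space Y ->
  (~ isolated (enveloping g) id) <->
  limit_point (range (iterz g) : set {ptws Y -> Y}) id.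
Proof.
move=> T1; rewrite not_isolatedP; last by apply: subset_closure; exists 0%R.
by rewrite limit_point_closure //; exact: accessible_ptws.
Qed.

Lemma iter_enveloping_map (n : nat) (p : enveloping g) :
  set_val (iter n (@enveloping_map _ g) p) = iter n g \o set_val p.
Proof.
elim: n => // n IHn.
by rewrite iterS -[RHS]/(g \o (iter n g \o set_val p)) -IHn.
Qed.

(** The singleton of the identity is open in the semigroup; a return of this
    open set to itself says that [iter n g \o id] is [id]. *)
Lemma transitive_isolated_periodic :
  topologically_transitive (@enveloping_map _ g) ->
  isolated (enveloping g) id -> exists2 n, (0 < n)%N & iter n g = id.
Proof.
move=> tr [/set_mem Eid [V + VE]]; rewrite nbhsE => -[W [oW Wid] WV].
pose U : set (enveloping g) := set_val @^-1` W.
have oU : open U by exists W.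
have U0 : U !=set0 by exists (exist _ id (mem_set Eid)).
have valU p : U p -> set_val p = id.
  move=> Up; suff : (V `&` enveloping g) (set_val p) by rewrite VE.
  by split; [exact: WV | exact: set_valP].
have [n n0 [_ [[p Up <-] Unp]]] := tr _ _ oU oU U0 U0.
exists n => //; have := valU _ Unp; rewrite iter_enveloping_map.
by rewrite (valU _ Up).
Qed.

(** Powers [g^m] and [g^l] lie in the two open sets, and
    [g^(n k + l - m) \o g^m = g^l \o g^(n k)] tends to [g^l] since left
    composition with a continuous map is pointwise continuous. *)
Lemma rigid_transitive (n : nat -> nat) :
  {homo n : i j / (i < j)%N} ->
  {ptws, (fun k => iter (n k) g) @ \oo --> (id : Y -> Y)} ->
  topologically_transitive (@enveloping_map _ g).
Proof.
move=> n_incr n_id _ _ [U oU <-] [V oV <-] [p Up] [q Vq].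
have [_ [[m _ <-] Um]] := set_valP p _ (open_nbhs_nbhs (conj oU Up)).
have [_ [[l _ <-] Vl]] := set_valP q _ (open_nbhs_nbhs (conj oV Vq)).
have n_ge k : (k <= n k)%N.
  by elim: k => // k IHk; exact: leq_ltn_trans IHk (n_incr _ _ (ltnSn k)).
have Vnear : \forall k \near \oo, V (iterz g l \o iter (n k) g).
  apply: (n_id (comp (iterz g l) @^-1` V)).
  apply: (ptws_comp_continuous _ _ (iterz_continuous _ g l)).
  exact: open_nbhs_nbhs.
(* This bound on k makes the exponent N below positive. *)
have [k [Vk k_big]] :=
  filter_ex (filterI Vnear (nbhs_infty_gt (absz (m - l)%R))).
have nk := n_ge k; rewrite /= in k_big.
pose N := absz ((n k)%:Z + l - m)%R.
have NE : (N%:Z + m = l + (n k)%:Z)%R by rewrite /N; lia.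
exists N; first by rewrite /N; lia.
have Em : enveloping g (iterz g m) by apply: subset_closure; exists m.
pose pm : enveloping g :=
  exist (fun r => r \in enveloping g) (iterz g m) (mem_set Em).
exists (iter N (@enveloping_map _ g) pm); split; first by exists pm.
rewrite /= iter_enveloping_map /=.
rewrite (_ : _ \o _ = iterz g l \o iter (n k) g) //.
apply/funext => y /=.
by have := iterzD _ g N m y; rewrite NE iterzD /= => <-.
Qed.

End enveloping_semigroup.

(** * The hyperspace and the induced map *)

Section hyperspace_theory.
Variable X : topologicalType.

Lemma vietoris_subbase_open (U : set (hyperspace X)) :
  vietoris_subbase U -> open U.
Proof.
move=> SU; exists [set U]; last by rewrite bigcup_set1.
move=> _ ->; exists [fset U]%fset; last by rewrite set_fset1 bigcap_set1.
by move=> V /fset1P ->; exact: mem_set.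
Qed.

Lemma open_hypersub (U : set X) : open U ->
  open [set A : hyperspace X | sval A `<=` U].
Proof. by move=> oU; apply: vietoris_subbase_open; left; exists U. Qed.

Lemma open_hypermeet (U : set X) : open U ->
  open [set A : hyperspace X | sval A `&` U !=set0].
Proof. by move=> oU; apply: vietoris_subbase_open; right; exists U. Qed.

Lemma vietoris_cvg (F : set_system (hyperspace X)) (A : hyperspace X) :
  Filter F ->
  (forall U, open U -> sval A `<=` U -> F [set B | sval B `<=` U]) ->
  (forall U, open U -> sval A `&` U !=set0 ->
     F [set B | sval B `&` U !=set0]) ->
  F --> A.
Proof.
move=> FF Fsub Fmeet W; rewrite nbhsE /= => -[_ [[D sD <-] [B DB BA]] sDW].
have [J sJ JB] := sD _ DB; move: BA; rewrite -JB => JA.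
apply: (@filterS _ F _ B); first by move=> C BC; apply: sDW; exists B.
rewrite -JB; apply: filter_bigI => V JV.
have := JA _ JV; have := sJ _ JV; rewrite inE.
by case=> -[U oU <-] /=; [exact: Fsub | exact: Fmeet].
Qed.

(** A point of [A] outside [B] separates them by an open set of sets meeting
    the complement of [B]; if there is none, a point [x] of [B] outside [A]
    separates them by the open set of sets avoiding [x]. *)
Lemma accessible_hyperspace :
  accessible_space X -> accessible_space (hyperspace X).
Proof.
move=> T1 A B /eqP AB.
have [AsubB|/existsNP [x /not_implyP [Ax nBx]]] :=
  pselect (sval A `<=` sval B).
  have [x [Bx nAx]] : exists x, sval B x /\ ~ sval A x.
    apply: contrapT => /forallNP H; apply: AB; apply: hyperspace_inj.
    by apply/seteqP; split => // x Bx; apply: contrapT => nAx; exact: (H x).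
  exists [set C : hyperspace X | sval C `<=` ~` [set x]]; split.
  - apply: open_hypersub; apply: closed_openC.
    exact: accessible_closed_set1.
  - by rewrite inE => y Ay yx; apply: nAx; rewrite -yx.
  - by rewrite inE => /(_ _ Bx); apply.
exists [set C : hyperspace X | sval C `&` ~` sval B !=set0]; split.
- by apply: open_hypermeet; apply: closed_openC; exact: (svalP B).1.
- by rewrite inE; exists x.
- by rewrite inE => -[y []].
Qed.

Lemma iter_induced (f : homeo X) (n : nat) (A : hyperspace X) :
  sval (iter n (induced f) A) = iter n f @` sval A.
Proof.
elim: n => [|n IHn]; first by rewrite image_id.
by rewrite iterS /= IHn image_comp.
Qed.

Lemma iterz_induced (f : homeo X) (n : int) (A : hyperspace X) :
  sval (iterz (induced f) n A) = iterz f n @` sval A.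
Proof.
case: n => n; first exact: iter_induced.
exact: (iter_induced (homeo_sym f) n.+1).
Qed.

Lemma induced_iter_id (f : homeo X) (n : nat) : accessible_space X ->
  iter n (induced f) = id -> iter n f = id.
Proof.
move=> T1 fn; apply/funext => x.
have x0 : closed [set x] /\ [set x] !=set0.
  by split; [exact: accessible_closed_set1 | exists x].
have := iter_induced f n (exist _ _ x0); rewrite fn /= image_set1.
by move=> /seteqP[/(_ x erefl)].
Qed.

End hyperspace_theory.

(** * Uniform rigidity and the hyperspace *)

(** Each [x] in [A] has an entourage neighbourhood inside [U]; halving the
    entourage leaves room both to move [x] and to apply [h i], uniformly near
    [x], so that compactness of [A] applies. *)
Lemma uniform_cvg_compact_sub (X : uniformType) (I : Type) (F : set_system I)
    (h : I -> X -> X) (A U : set X) : Filter F ->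
  {uniform, h @ F --> (id : X -> X)} -> compact A -> open U -> A `<=` U ->
  \forall i \near F, h i @` A `<=` U.
Proof.
move=> FF hF /compact_near_coveringP cA oU AU.
have cover x : A x -> \forall x' \near x & i \near F, U (h i x').
  move=> Ax; have : nbhs x U by apply: open_nbhs_nbhs; split => //; exact: AU.
  rewrite -nbhs_entourageE => -[E entE EU].
  exists (xsection (split_ent E) x,
    [set i | forall y, split_ent E (y, h i y)]).
    split; first exact: nbhs_entourage (entourage_split_ent entE).
    have : nbhs (id : {uniform X -> X})
        [set k | forall y, split_ent E (y, k y)].
      apply/uniform_nbhs; exists (split_ent E); split => //.
      by move=> k /= kE y; exact: kE.
    exact: hF.
  move=> [x' i] /= [/xsectionP xx' hE]; apply: EU; apply/xsectionP.
  exact: entourage_split (hE x').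
have := cA I F (fun i x => U (h i x)) FF cover; apply: filterS.
by move=> i hU _ [x Ax <-]; exact: hU.
Qed.

Lemma uniform_cvg_induced (X : uniformType) (f : homeo X) (n : nat -> nat) :
  compact [set: X] ->
  {uniform, (fun k => iter (n k) f) @ \oo --> (id : X -> X)} ->
  {ptws, (fun k => iter (n k) (induced f)) @ \oo -->
    (id : hyperspace X -> hyperspace X)}.
Proof.
move=> cX fn; apply: ptws_cvg => A; apply: vietoris_cvg => U oU AU.
  have cA : compact (sval A).
    by rewrite -[sval A]setTI; apply: compact_closedI => //; exact: (svalP A).1.
  have fA := uniform_cvg_compact_sub _ _ _ _ _ _ eventually_filter fn cA oU AU.
  suff : \forall k \near \oo, sval (iter (n k) (induced f) A) `<=` U by [].
  by apply: filterS fA => k; rewrite iter_induced.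
have [x [Ax Ux]] := AU.
suff : \forall k \near \oo, sval (iter (n k) (induced f) A) `&` U !=set0 by [].
have x1U : [set x] `<=` U by move=> _ ->.
have := uniform_cvg_compact_sub _ _ _ _ _ _ eventually_filter
  fn (@compact_set1 _ x) oU x1U.
apply: filterS => k fU; rewrite iter_induced.
by exists (iter (n k) f x); split; [exists x | apply: fU; exists x].
Qed.

Section uniform_rigidity.
Context {R : realType} {X : pseudoMetricType R}.
Local Open Scope ring_scope.

Lemma ball_iter (h : X -> X) (e : R) (n : nat) :
  0 < e -> (forall x, ball x e (h x)) ->
  forall x, ball x (e *+ n.+1) (iter n.+1 h x).
Proof.
move=> e0 he; elim: n => [|n IHn] x; first exact: he.
by rewrite mulrSr; apply: ball_triangle (IHn x) _; exact: he.
Qed.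

(** The return times given by the hypothesis might stay bounded as [e] shrinks.
    A multiple [N.+1 * n] of a return time for [e / N.+1] is a return time for
    [e] larger than [N], which gives a strictly increasing sequence. *)
Lemma uniformly_rigid_ball (f : X -> X) :
  (forall e : R, 0 < e ->
     exists2 n, (0 < n)%N & forall x, ball x e (iter n f x)) ->
  uniformly_rigid f.
Proof.
move=> fe.
have step (k N : nat) :
    {n | (N < n)%N & forall x, ball x k.+1%:R^-1 (iter n f x)}.
  have d0 : (0 : R) < k.+1%:R^-1 / N.+1%:R by rewrite divr_gt0 ?invr_gt0 ?ltr0n.
  apply: cid2; have [n n0 fn] := fe _ d0; exists (N.+1 * n)%N.
    by nia.
  move=> x; rewrite iterM.
  have -> : k.+1%:R^-1 = (k.+1%:R^-1 / N.+1%:R) *+ N.+1 :> R.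
    by rewrite -[RHS]mulr_natr divfK ?pnatr_eq0.
  exact: ball_iter.
pose n := fix n k := s2val (step k (if k is j.+1 then n j else 0%N)).
have n_lt k : (n k < n k.+1)%N by exact: s2valP (step _ _).
exists n; split; last 1 first.
- move=> P /uniform_nbhs[E [entE EP]].
  move: entE; rewrite -entourage_ballE => -[e e0 eE].
  have : \forall k \near \oo, k.+1%:R^-1 < e.
    by exact: (near_infty_natSinv_lt (PosNum e0)).
  apply: filterS => k ke; apply: EP => x _; apply: eE.
  apply: le_ball (ltW ke) _ _.
  by case: k {ke} => [|k]; exact: s2valP' (step _ _) x.
- by case=> [|k]; [exact: s2valP (step _ _)|exact: leq_ltn_trans (n_lt k)].
- by apply: homo_ltn; [exact: ltn_trans|exact: n_lt].
Qed.

Lemma closure_ball_interior (x : X) (d : R) : 0 < d ->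
  closure (ball x d) `<=` (ball x (d + d + d))^°.
Proof.
move=> d0 y; have yd : nbhs y (ball y d) by exact: (nbhsx_ballx y d d0).
move=> /(_ _ yd)[z [xz yz]]; apply: filterS yd => w yw.
exact: ball_triangle (ball_triangle xz (ball_sym yz)) yw.
Qed.

(** Around [x], take the pointwise neighbourhood of the identity that sends the
    single closed set [closure (ball x d)] into a slightly larger ball: a power
    of the induced map in it moves every point of [ball x d] by less than
    [4 * d].  Compactness of [X] makes one neighbourhood work for all [x]. *)
Lemma induced_recurrence_ball (f : homeo X) (e : R) :
  compact [set: X] -> 0 < e ->
  nbhs (id : {ptws hyperspace X -> hyperspace X})
    [set p | forall n, p = iterz (induced f) n ->
               forall x, ball x e (iterz f n x)].
Proof.
move=> cX e0; pose d := e / 4; have d0 : 0 < d by rewrite divr_gt0.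
have clA (x : X) : closed (closure (ball x d)) /\ closure (ball x d) !=set0.
  split; first exact: closed_closure.
  by exists x; apply: subset_closure; exact: ballxx.
pose A (x : X) : hyperspace X := exist _ _ (clA x).
pose self := {ptws hyperspace X -> hyperspace X}.
pose P (p : self) x :=
  forall n, p = iterz (induced f) n -> ball x e (iterz f n x).
have near_id (x : X) : \forall x' \near x & p \near (id : self), P p x'.
  exists (ball x d, [set p : {ptws hyperspace X -> hyperspace X} |
      sval (p (A x)) `<=` (ball x (d + d + d))^°]).
    split; first exact: nbhsx_ballx.
    apply: (@ptws_eval _ (A x) id
      [set B | sval B `<=` (ball x (d + d + d))^°]).
    apply: open_nbhs_nbhs; split.
      by apply: open_hypersub; exact: open_interior.
    exact: closure_ball_interior.
  move=> [x' p] /= [xx' pA] n pn.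
  have xfx' : ball x (d + d + d) (iterz f n x').
    apply: interior_subset; apply: pA.
    have -> : p (A x) = iterz (induced f) n (A x) by rewrite pn.
    by rewrite iterz_induced; exists x' => //; exact: subset_closure.
  have -> : e = d + (d + d + d).
    by rewrite -addrA -[RHS]/(d *+ 4) -mulr_natr divfK ?pnatr_eq0.
  exact: ball_triangle (ball_sym xx') xfx'.
have /compact_near_coveringP covX := cX.
have := covX _ _ P (nbhs_filter (id : self)) (fun x _ => near_id x).
by apply: filterS => p pX n pn x; exact: pX.
Qed.

Lemma limit_point_uniformly_rigid (f : homeo X) : compact [set: X] ->
  limit_point (range (iterz (induced f)) :
    set {ptws hyperspace X -> hyperspace X}) id ->
  uniformly_rigid f.
Proof.
move=> cX id_lim; apply: uniformly_rigid_ball => e e0.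
have [p [/eqP p_id [n _ np] /(_ n (esym np)) fn]] :=
  id_lim _ (induced_recurrence_ball f e cX e0).
case: n np fn => [[|m]|m] np fn; first by case: p_id; rewrite -np.
- by exists m.+1.
- (* For a negative exponent, the estimate at f^(m+1) x is read backwards. *)
  exists m.+1 => // x.
  have := fn (iter m.+1 f x); rewrite [iterz _ _ _](_ : _ = x).
    exact: ball_sym.
  by rewrite /= -iterS; exact: iter_homeo_invK.
Qed.

End uniform_rigidity.

(** * The equivalence *)

Theorem theorem10p5 (R : realType) (X : metricType R)
    (cptX : compact [set: X]) (f : homeo X)
    (infE : infinite_set (enveloping f)) :
  [/\ topologically_transitive (@enveloping_map _ (induced f)) <->
        ~ isolated (enveloping (induced f)) id,
      ~ isolated (enveloping (induced f)) id <-> uniformly_rigid f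
    & uniformly_rigid f ->
        topologically_transitive (@enveloping_map _ f)].
Proof.
have T1 : accessible_space X by exact/hausdorff_accessible/metric_hausdorff.
have T1h := accessible_hyperspace _ T1.
have aperiodic n : (0 < n)%N -> iter n (induced f) <> id.
  move=> n0 /(induced_iter_id _ _ _ T1) fn; apply: infE.
  exact: periodic_enveloping_finite T1 n0 fn.
have transitive_not_isolated :
    topologically_transitive (@enveloping_map _ (induced f)) ->
    ~ isolated (enveloping (induced f)) id.
  by move=> tr /(transitive_isolated_periodic _ _ tr)[n /aperiodic].
have not_isolated_rigid :
    ~ isolated (enveloping (induced f)) id -> uniformly_rigid f.
  by move=> /(not_isolated_id _ _ T1h); exact: limit_point_uniformly_rigid.
have rigid_transitive_induced :
    uniformly_rigid f ->
    topologically_transitive (@enveloping_map _ (induced f)).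
  move=> [n [_ n_incr fn]]; apply: rigid_transitive n_incr _.
  exact: uniform_cvg_induced.
split; first by split=> [//|/not_isolated_rigid].
  by split=> [//|/rigid_transitive_induced].
move=> [n [_ n_incr fn]]; apply: rigid_transitive n_incr _.
exact: pointwise_uniform_cvg.
Qed.
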